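(* Let $R$ be an integral domain, and let $\mathcal{A}=(A_1,A_2,\dots)$ and $\mathcal{B}=(B_1,B_2,\dots)$ be two elements of $V_n(R)$ of the same length $n\in\mathbb{N}\cup\{\infty\}$. Then $\mathcal{A}\sim\mathcal{B}$ if and only if $\mathcal{A}_J\sim\mathcal{B}_J$ for all index vectors $J$ of length $\leq 3$. Moreover, if $n\geq 3$ and $[A_1,A_2]\neq 0$, then $\mathcal{A}$ is similar to $\mathcal{B}$ if and only if $(A_1,A_2,A_j)\sim(B_1,B_2,B_j)$ for all indices $j$ with $3\le j\le n$ ($j\geq 3$ if $n=\infty$).
   Context: For an integral domain $R$ and $n\in\mathbb{N}\cup\{\infty\}$, $V_n(R)$ is the set of sequences $\mathcal{A}=(A_1,A_2,\dots)$ of length $n$ of $2\times 2$ matrices over $R$. The group $GL_2(R)$ acts by simultaneous conjugation, $g\cdot\mathcal{A}=(gA_1g^{-1},gA_2g^{-1},\dots)$. Two sequences of the same length are similar, written $\mathcal{A}\sim\mathcal{B}$, if $\mathcal{B}=g\cdot\mathcal{A}$ for some $g\in GL_2(R)$. For $J=(j_1,\dots,j_l)$ with $1\le j_1<\dots<j_l\le n$, of length $l$, $\mathcal{A}_J=(A_{j_1},\dots,A_{j_l})$. $[A,B]=AB-BA$. *)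

(* Defs.v *)
From HB Require Import structures.
From mathcomp Require Import all_boot all_order all_algebra.
Set Implicit Arguments.
Unset Strict Implicit.
Unset Printing Implicit Defensive.
Import GRing.Theory.
Local Open Scope ring_scope.

(* The lengths n in N u {oo}. *)
Variant seqlen := Len of nat | Infinite.
Coercion Len : nat >-> seqlen.

Definition leq_len (m : nat) (n : seqlen) : bool :=
  if n is Len k then (m <= k)%N else true.

(* Indices are numbered from 1. *)
Record idx (n : seqlen) := Idx {
  idx_val :> nat;
  idxP : (0 < idx_val)%N && leq_len idx_val n
}.

HB.instance Definition _ (n : seqlen) := [isSub for @idx_val n].
HB.instance Definition _ (n : seqlen) := [Equality of idx n by <:].

Lemma leq_len_trans (k m : nat) (n : seqlen) :
  (k <= m)%N -> leq_len m n -> leq_len k n.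
Proof. by case: n => //= n; apply: leq_trans. Qed.

Definition idx1 (n : seqlen) (n3 : leq_len 3 n) : idx n :=
  @Idx n 1 (leq_len_trans (isT : (1 <= 3)%N) n3).

Definition idx2 (n : seqlen) (n3 : leq_len 3 n) : idx n :=
  @Idx n 2 (leq_len_trans (isT : (2 <= 3)%N) n3).

Definition V (R : idomainType) (n : seqlen) := idx n -> 'M[R]_2.

(* Since indices start at 1, the i-th term is the entry of rank i.-1. *)
Definition V_of_tuple (R : idomainType) (l : nat) (t : l.-tuple 'M[R]_2) :
  V R l := fun i => t`_(i.-1).

Definition conjV (R : idomainType) (n : seqlen) (g : 'M[R]_2) (A : V R n) :
  V R n := fun j => g *m A j *m invmx g.

(* GL_2(R) is the set of the g : 'M[R]_2 such that g \in unitmx; equality of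
   sequences is taken pointwise. *)
Definition similarV (R : idomainType) (n : seqlen) (A B : V R n) : Prop :=
  exists2 g : 'M[R]_2, g \in unitmx & B =1 conjV g A.

Definition index_vector (n : seqlen) (l : nat) (J : l.-tuple (idx n)) : bool :=
  sorted ltn [seq idx_val j | j <- J].

Definition subV (R : idomainType) (n : seqlen) (A : V R n)
    (l : nat) (J : l.-tuple (idx n)) : V R l :=
  V_of_tuple (map_tuple A J).

Definition mxcommutator (R : idomainType) (X Y : 'M[R]_2) : 'M[R]_2 :=
  X *m Y - Y *m X.

(* Main.v *)
(** Two commuting 2x2 matrices X and Y with X non-scalar satisfy c Y = a + b X
    with c != 0.  Consequently the matrices commuting with both members of a
    non-commuting pair are scalar, so the conjugation taking one non-commuting
    pair to another is unique, and triples containing that pair determine it.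
    If instead all the A_j commute and A_i is not scalar, then c A_j = a + b A_i,
    and similarity of the pairs gives c B_j = a + b B_i, so that every g taking
    A_i to B_i takes A_j to B_j.  If all the A_j are scalar then A = B. *)
Require Import Defs.
From mathcomp Require Import all_boot all_order all_algebra.
From mathcomp Require Import ring.
From Stdlib Require Import Classical.
Import GRing.Theory.
Local Open Scope ring_scope.

Section TwoByTwo.
Variable R : idomainType.
Implicit Types X Y Z g h : 'M[R]_2.

Lemma eq_mx2 X Y :
  X 0 0 = Y 0 0 -> X 0 1 = Y 0 1 -> X 1 0 = Y 1 0 -> X 1 1 = Y 1 1 -> X = Y.
Proof.
move=> e00 e01 e10 e11; apply/matrixP=> i j.
have ord2 (k : 'I_2) : k = 0 \/ k = 1.
  by case: k => [[|[|k]] lt_k2] //; [left | right]; apply: val_inj.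
by case: (ord2 i) => ->; case: (ord2 j) => ->.
Qed.

Lemma mulmx2E X Y i j : (X *m Y) i j = X i 0 * Y 0 j + X i 1 * Y 1 j.
Proof.
by rewrite mxE !big_ord_recl big_ord0 addr0; congr (_ + X _ _ * Y _ _);
   apply: val_inj.
Qed.

Lemma scalemx_injective (c : R) (m n : nat) :
  c != 0 -> injective (fun M : 'M[R]_(m, n) => c *: M).
Proof.
move=> c0 M N /matrixP eMN; apply/matrixP=> i j.
by have := eMN i j; rewrite !mxE; apply: mulfI.
Qed.

Lemma nonscalar_mx2 X :
  ~~ is_scalar_mx X -> [|| X 0 1 != 0, X 1 0 != 0 | X 0 0 - X 1 1 != 0].
Proof.
apply: contraNT; rewrite !negb_or !negbK subr_eq0.
case/and3P=> /eqP e01 /eqP e10 /eqP e.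
by apply/is_scalar_mxP; exists (X 0 0); apply: eq_mx2; rewrite !mxE //= ?mulr1n.
Qed.

(** The entries of [X *m Y - Y *m X] are, up to sign, the 2x2 minors of the vectors
    [(X 0 1, X 1 0, X 0 0 - X 1 1)] and its analogue for [Y]. Commuting makes these vectors
    proportional; [c] is a nonzero coordinate of the first and [b] the same coordinate of the
    second. *)
Lemma comm_mx2_proportional X Y :
    comm_mx X Y -> ~~ is_scalar_mx X ->
  exists c a b, c != 0 /\ c *: Y = a%:M + b *: X.
Proof.
move=> cXY /nonscalar_mx2.
have e00 : X 0 1 * Y 1 0 - Y 0 1 * X 1 0 = 0.
  have /matrixP/(_ 0 0) := cXY; rewrite !mulmx2E => /eqP.
  by rewrite -subr_eq0 => /eqP <-; ring.
have e01 : (X 0 0 - X 1 1) * Y 0 1 - (Y 0 0 - Y 1 1) * X 0 1 = 0.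
  have /matrixP/(_ 0 1) := cXY; rewrite !mulmx2E => /eqP.
  by rewrite -subr_eq0 => /eqP <-; ring.
have e10 : (Y 0 0 - Y 1 1) * X 1 0 - (X 0 0 - X 1 1) * Y 1 0 = 0.
  have /matrixP/(_ 1 0) := cXY; rewrite !mulmx2E => /eqP.
  by rewrite -subr_eq0 => /eqP <-; ring.
have wit c b :
    c * Y 0 1 = b * X 0 1 -> c * Y 1 0 = b * X 1 0 ->
    c * (Y 0 0 - Y 1 1) = b * (X 0 0 - X 1 1) -> c != 0 ->
  exists c a b, c != 0 /\ c *: Y = a%:M + b *: X.
  (* The value of [a] is forced by the entry at [0 0]; the entry at [1 1] then amounts to [p]. *)
  move=> p01 p10 p c0; exists c, (c * Y 0 0 - b * X 0 0), b; split=> //.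
  apply: eq_mx2; rewrite !mxE /= ?mulr1n ?mulr0n ?add0r ?subrK //.
  apply/eqP; rewrite -subr_eq0; apply/eqP.
  transitivity (b * (X 0 0 - X 1 1) - c * (Y 0 0 - Y 1 1)); first by ring.
  by rewrite p subrr.
case/or3P; [apply: (wit _ (Y 0 1)) | apply: (wit _ (Y 1 0))
           | apply: (wit _ (Y 0 0 - Y 1 1))];
  apply/eqP; rewrite -subr_eq0; apply/eqP.
- by ring.
- by rewrite -e00; ring.
- by rewrite -oppr0 -e01; ring.
- by rewrite -oppr0 -e00; ring.
- by ring.
- by rewrite -e10; ring.
- by rewrite -e01; ring.
- by rewrite -oppr0 -e10; ring.
- by ring.
Qed.

(** Otherwise [c *: X] would be a polynomial in [h] and so commute with [Y]; cancelling [c]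
    contradicts the first hypothesis. *)
Lemma centralizer_noncommuting X Y h :
    mxcommutator X Y <> 0 -> comm_mx h X -> comm_mx h Y -> is_scalar_mx h.
Proof.
move=> nXY hX hY; apply/negPn/negP => hns; apply: nXY.
have [c [a [b [c0 eX]]]] := comm_mx2_proportional _ _ hX hns.
have hcX : comm_mx Y (c *: X).
  rewrite eX; apply: comm_mxD; first exact: comm_mx_scalar.
  by apply: comm_mx_sym; rewrite /comm_mx -scalemxAl hY scalemxAr.
apply: (scalemx_injective _ _ _ c0); rewrite scaler0 /mxcommutator scalerBr.
by rewrite scalemxAl -hcX scalemxAr subrr.
Qed.

Lemma conj_intertwine g X Y : g \in unitmx ->
  (Y = g *m X *m invmx g) <-> (Y *m g = g *m X).
Proof.
move=> gU; split=> [->|e]; first by rewrite mulmxKV.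
by rewrite -e mulmxK.
Qed.

(** The matrix [invmx g *m g'] commutes with [X] and [Y], hence is scalar, so [g'] is a scalar
    multiple of [g] and inherits its relations. *)
Lemma intertwiner_unique g g' X Y Z X' Y' Z' :
    mxcommutator X Y <> 0 -> g \in unitmx ->
    X' *m g = g *m X -> Y' *m g = g *m Y ->
    X' *m g' = g' *m X -> Y' *m g' = g' *m Y ->
  Z' *m g = g *m Z -> Z' *m g' = g' *m Z.
Proof.
move=> nXY gU gX gY gX' gY' gZ; pose h := invmx g *m g'.
have eg' : g' = g *m h by rewrite mulKVmx.
have hcomm T T' : T' *m g = g *m T -> T' *m g' = g' *m T -> comm_mx h T.
  move=> gT g'T; rewrite /comm_mx -mulmxA -g'T {1}eg' !mulmxA.
  by rewrite -[invmx g *m T' *m g]mulmxA gT mulKmx.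
have /is_scalar_mxP[a ha] :=
  centralizer_noncommuting _ _ h nXY (hcomm _ _ gX gX') (hcomm _ _ gY gY').
by rewrite eg' ha mul_mx_scalar -scalemxAr gZ scalemxAl.
Qed.

End TwoByTwo.

Section Sequences.
Variable R : idomainType.

Lemma similarV_intertwine (n : seqlen) (A B : V R n) :
  similarV A B <->
  exists2 g, g \in unitmx & forall j, B j *m g = g *m A j.
Proof.
by split=> -[g gU e]; exists g => // j; apply/(conj_intertwine _ _ _ _ gU)/e.
Qed.

Lemma similarV_tuple (l : nat) (s t : l.-tuple 'M[R]_2) :
  similarV (V_of_tuple s) (V_of_tuple t) <->
  exists2 g, g \in unitmx & forall i, (i < l)%N -> t`_i *m g = g *m s`_i.
Proof.
rewrite similarV_intertwine; split=> -[g gU e]; exists g => // i.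
  by move=> ltil; apply: (e (@Idx l i.+1 ltil)).
by apply: e; case: i => [[]].
Qed.

Lemma similarV_sub (n : seqlen) (A B : V R n) (l : nat) (J : l.-tuple (idx n)) :
  similarV (subV A J) (subV B J) <->
  exists2 g, g \in unitmx & forall j, j \in J -> B j *m g = g *m A j.
Proof.
rewrite similarV_tuple; split=> -[g gU e]; exists g => //; [move=> j jJ | move=> i ltil].
  have := jJ; rewrite -index_mem size_tuple => /e.
  by rewrite !(nth_map j) ?index_mem // nth_index.
(* A default for [nth]: the bound on [i] makes [J] nonempty. *)
have j : idx n by case: l J {e} ltil => // l J _; exact: thead J.
rewrite !(nth_map j) ?size_tuple //; apply: e.
by rewrite mem_nth ?size_tuple.
Qed.

(** Frees later arguments from the order and distinctness of indices: sorting a duplicate-free copy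
    of [s] gives an index vector with the same members. *)
Lemma similarV_on_seq (n : seqlen) (A B : V R n) (m : nat) :
    (forall (l : nat) (J : l.-tuple (idx n)),
       index_vector J -> (l <= m)%N -> similarV (subV A J) (subV B J)) ->
  forall s : seq (idx n), (size s <= m)%N ->
  exists2 g, g \in unitmx & forall j, j \in s -> B j *m g = g *m A j.
Proof.
move=> simAB s le_sm.
pose t := sort (relpre (@idx_val n) leq) (undup s).
have t_idx : index_vector (in_tuple t).
  rewrite /index_vector ltn_sorted_uniq_leq map_inj_uniq; last exact: val_inj.
  rewrite sort_uniq undup_uniq /=.
  by rewrite sorted_map sort_sorted // => i j; apply: leq_total.
have t_size : (size t <= m)%N by rewrite size_sort (leq_trans (size_undup s)).
have /similarV_sub[g gU e] := simAB _ _ t_idx t_size.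
by exists g => // j js; apply: e; rewrite [_ \in _]mem_sort mem_undup.
Qed.

Lemma similarV_local (n : seqlen) (A B : V R n) :
    (forall s : seq (idx n), (size s <= 3)%N ->
       exists2 g, g \in unitmx & forall j, j \in s -> B j *m g = g *m A j) ->
  similarV A B.
Proof.
move=> loc; apply/similarV_intertwine.
(* The index set may be infinite, so this case split is classical. *)
have [[i [j nij]]|comA] :=
  classic (exists i j, mxcommutator (A i) (A j) <> 0).
  have [g gU e] := loc [:: i; j] isT.
  exists g => // k; have [g' gU' e'] := loc [:: i; j; k] isT.
  by apply: (intertwiner_unique _ g' _ (A i) (A j) _ (B i) (B j));
    rewrite // ?e ?e' ?inE ?eqxx ?orbT.
have {}comA i j : comm_mx (A i) (A j).
  apply/eqP; rewrite -subr_eq0; apply/negPn/negP => /eqP nij.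
  by apply: comA; exists i, j.
have [[i nsi]|scalA] := classic (exists i, ~~ is_scalar_mx (A i)).
  have [g gU e] := loc [:: i] isT.
  exists g => // j; have [g' gU' e'] := loc [:: i; j] isT.
  have [c [a [b [c0 eA]]]] := comm_mx2_proportional _ _ _ (comA i j) nsi.
  (* The matrix [g'] carries the relation [eA] over to [B]. It depends on [j], but [eB] no longer
     mentions it, so the fixed [g] can be used below. *)
  have eB : c *: B j = a%:M + b *: B i.
    apply: (can_inj (mulmxK gU')); rewrite mulmxDl -!scalemxAl.
    by rewrite !e' ?inE ?eqxx ?orbT // !scalemxAr eA mulmxDr scalar_mxC.
  apply: (scalemx_injective _ _ _ _ c0); rewrite scalemxAl eB scalemxAr eA mulmxDl mulmxDr.
  by rewrite scalar_mxC -scalemxAl -scalemxAr e ?inE.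
(* All [A j] are scalar, and conjugation fixes scalar matrices. *)
exists 1%:M => [|j]; first exact: unitmx1.
have [g gU /(_ j) e] := loc [:: j] isT.
have /is_scalar_mxP[a Aj] : is_scalar_mx (A j).
  by apply/negPn/negP => nsj; apply: scalA; exists j.
apply: (can_inj (mulmxK gU)).
by rewrite mulmx1 mul1mx e ?inE // Aj scalar_mxC.
Qed.

Lemma similarV_triple (n : seqlen) (A B : V R n) (i j k : idx n) :
  similarV (V_of_tuple [tuple A i; A j; A k]) (V_of_tuple [tuple B i; B j; B k])
  <-> exists2 g, g \in unitmx &
        [/\ B i *m g = g *m A i, B j *m g = g *m A j & B k *m g = g *m A k].
Proof.
rewrite similarV_tuple; split=> -[g gU e]; exists g => //.
  by split; [apply: (e 0) | apply: (e 1) | apply: (e 2)].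
by case: e => ei ej ek [|[|[|]]].
Qed.

Lemma idx_cases (n : seqlen) (n3 : leq_len 3 n) (j : idx n) :
  [\/ j = idx1 n3, j = idx2 n3 | (3 <= j)%N].
Proof.
have [le3j|] := leqP 3 j; first by constructor 3.
case: j => [[|[|[|j]]] jP] //= _; last by constructor 2; apply: val_inj.
by constructor 1; apply: val_inj.
Qed.

End Sequences.

Theorem proposition1p10 (R : idomainType) (n : seqlen) (A B : V R n) :
  (similarV A B <->
     (forall (l : nat) (J : l.-tuple (idx n)),
        index_vector J -> (l <= 3)%N -> similarV (subV A J) (subV B J)))
  /\
  (forall n3 : leq_len 3 n,
     mxcommutator (A (idx1 n3)) (A (idx2 n3)) <> 0 ->
     (similarV A B <->
        (forall j : idx n, (3 <= j)%N ->
           similarV (V_of_tuple [tuple A (idx1 n3); A (idx2 n3); A j])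
                   (V_of_tuple [tuple B (idx1 n3); B (idx2 n3); B j])))).
Proof.
split=> [|n3 n12].
  split=> [/similarV_intertwine[g gU e] l J _ _ | simAB].
    by apply/similarV_sub; exists g.
  by apply: similarV_local; apply: similarV_on_seq simAB.
split=> [/similarV_intertwine[g gU e] j _ | simAB].
  by apply/similarV_triple; exists g.
(* The index 3 serves only to produce one [g] for the first pair; each later [j] brings its own
   [g'], whose relation at [j] passes to [g] by uniqueness. *)
have /similarV_triple[g gU [e1 e2 _]] := simAB (@Idx n 3 n3) isT.
apply/similarV_intertwine; exists g => // j.
have [->|->|/simAB/similarV_triple[g' gU' [e1' e2' ej']]] // := idx_cases _ n3 j.
exact: (intertwiner_unique _ g' _ _ _ _ _ _ _ n12 gU' e1' e2' e1 e2 ej').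
Qed.
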